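(* Let $A\in\mathbb{C}$ with $A(A^2+4)\ne0$, and let $(w_i)_{i\ge0}$ be a sequence of complex numbers with $w_{i+1}=Aw_i+w_{i-1}$ for all $i=1,2,3,\ldots$. Then for any positive even integer $n$, the characteristic polynomial $\det[x\delta_{jk}-w_{j+k}]_{0\le j,k\le n-1}$ of the matrix $[w_{j+k}]_{0\le j,k\le n-1}$ equals $$x^n-\big(w_1v_{n-1}(A,-1)+w_0v_{n-2}(A,-1)\big)\frac{u_n(A,-1)}{A}\,x^{n-1}+(w_0^2+Aw_0w_1-w_1^2)\frac{u_n(A,-1)^2}{A^2}\,x^{n-2},$$ where $\delta_{jk}$ is $1$ if $j=k$ and $0$ otherwise.
   Context: For $a,b\in\mathbb{C}$, the Lucas sequences are defined by $u_0(a,b)=0$, $u_1(a,b)=1$, $v_0(a,b)=2$, $v_1(a,b)=a$, and $u_{m+1}(a,b)=au_m(a,b)-bu_{m-1}(a,b)$, $v_{m+1}(a,b)=av_m(a,b)-bv_{m-1}(a,b)$ for $m\ge1$. The convention $0^0=1$ is used. *)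

(* Defs.v *)
From mathcomp Require Import all_boot all_order all_algebra.
From mathcomp Require Import reals.
From mathcomp Require Import complex.

Set Implicit Arguments.
Unset Strict Implicit.
Unset Printing Implicit Defensive.

Import GRing.Theory.
Local Open Scope ring_scope.

(* The sequence s with s 0 = s0, s 1 = s1 and
   s (m + 1) = a * s m - b * s (m - 1) for m >= 1. *)
Fixpoint lucas_rec (K : pzRingType) (a b s0 s1 : K) (m : nat) : K :=
  match m with
  | 0 => s0
  | m1.+1 =>
      match m1 with
      | 0 => s1
      | m2.+1 => a * lucas_rec a b s0 s1 m1 - b * lucas_rec a b s0 s1 m2
      end
  end.

Definition lucas_u (K : pzRingType) (a b : K) (m : nat) : K :=
  lucas_rec a b 0 1 m.

Definition lucas_v (K : pzRingType) (a b : K) (m : nat) : K :=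
  lucas_rec a b 2 a m.

(* Main.v *)
Require Import Defs.
From mathcomp Require Import all_boot all_order all_algebra.
From mathcomp Require Import reals.
From mathcomp Require Import complex.
From mathcomp Require Import ring.

Set Implicit Arguments.
Unset Strict Implicit.
Unset Printing Implicit Defensive.

Import GRing.Theory.
Local Open Scope ring_scope.

(** Every solution of the recurrence is [w k = w 0 * g k + w 1 * u k], where
    [g] is the solution with [g 0 = 1] and [g 1 = 0].  Hence the Hankel matrix
    factors as [Q^T M Q], where the two rows of [Q] are [g] and [u], and [M] is
    the 2 x 2 Hankel matrix of [w 0, w 1, w 2].  Sylvester's identity for
    characteristic polynomials leaves the 2 x 2 matrix [M (Q Q^T)], whose
    entries are sums of products of [g] and [u]; for an even number of terms
    these sums have closed forms. *)

(** The block matrix [B] is made block triangular in two ways. A column operation of determinant 1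
    shows that its determinant is [char_poly (P *m Q)]; a row operation of determinant ['X^n] turns
    it into a matrix with diagonal blocks ['X%:M] and [char_poly_mx (Q *m P)]. *)
Lemma char_poly_mulmxC (R : comNzRingType) m n
    (P : 'M[R]_(m, n)) (Q : 'M[R]_(n, m)) :
  'X^n * char_poly (P *m Q) = 'X^m * char_poly (Q *m P).
Proof.
set p := map_mx polyC P; set q := map_mx polyC Q.
pose B := block_mx 'X%:M p q 1%:M : 'M[{poly R}]_(m + n).
have EL : B *m block_mx 1%:M 0 (- q) 1%:M =
          block_mx (char_poly_mx (P *m Q)) p 0 1%:M.
  rewrite mulmx_block !mulmx0 !mulmx1 !mul1mx !add0r subrr mulmxN.
  by rewrite /char_poly_mx map_mxM.
have ER : block_mx 1%:M 0 (- q) 'X%:M *m B =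
          block_mx 'X%:M p 0 (char_poly_mx (Q *m P)).
  rewrite mulmx_block !mul0mx !mul1mx !mulmx1 !addr0.
  rewrite mulNmx mul_mx_scalar mul_scalar_mx addNr mulNmx addrC.
  by rewrite /char_poly_mx map_mxM.
have := congr1 determinant EL; have := congr1 determinant ER.
rewrite !det_mulmx !det_lblock !det_ublock !det1 !det_scalar.
by rewrite !mul1r !mulr1 /char_poly => XB <-.
Qed.

Lemma det_mx2 (R : comNzRingType) (M : 'M[R]_2) :
  \det M = M 0 0 * M 1 1 - M 0 1 * M 1 0.
Proof.
rewrite (expand_det_row _ 0) !big_ord_recl big_ord0 /cofactor !det_mx11 !mxE.
have -> : lift (0 : 'I_2) 0 = 1 by apply/val_inj.
have -> : lift (1 : 'I_2) 0 = 0 by apply/val_inj.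
by rewrite /= /bump /=; ring.
Qed.

Lemma char_poly2 (R : comNzRingType) (M : 'M[R]_2) :
  char_poly M = 'X^2 - \tr M *: 'X + (\det M)%:P.
Proof.
rewrite /char_poly !det_mx2 /mxtrace !big_ord_recl big_ord0 !mxE /=.
have -> : lift (0 : 'I_2) 0 = 1 by apply/val_inj.
rewrite -mul_polyC !(polyCD, polyCB, polyCM, polyCN) addr0 /=.
by rewrite !mulr0n !mulr1n; ring.
Qed.

Section Lucas.
Variables (K : comNzRingType) (a : K).

Local Notation u := (lucas_u a (-1)).
Local Notation v := (lucas_v a (-1)).
Local Notation g := (lucas_rec a (-1) 1 0).

Lemma lucas_recSS s0 s1 m :
  lucas_rec a (-1) s0 s1 m.+2 =
  a * lucas_rec a (-1) s0 s1 m.+1 + lucas_rec a (-1) s0 s1 m.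
Proof. by rewrite /= mulN1r opprK. Qed.

Lemma lucas_uSS m : u m.+2 = a * u m.+1 + u m.
Proof. exact: lucas_recSS. Qed.

Lemma lucas_vSS m : v m.+2 = a * v m.+1 + v m.
Proof. exact: lucas_recSS. Qed.

Lemma recurrence_eq (w w' : nat -> K) :
    (forall i, w i.+2 = a * w i.+1 + w i) ->
    (forall i, w' i.+2 = a * w' i.+1 + w' i) ->
  w 0%N = w' 0%N -> w 1%N = w' 1%N -> w =1 w'.
Proof.
move=> hw hw' e0 e1 k; suff [] : w k = w' k /\ w k.+1 = w' k.+1 by [].
by elim: k => [//|k [ek eSk]]; split=> //; rewrite hw hw' ek eSk.
Qed.

Lemma recurrence_add (w : nat -> K) :
    (forall i, w i.+2 = a * w i.+1 + w i) ->
  forall j k, w (j + k)%N = w j * g k + w j.+1 * u k.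
Proof.
move=> hw j; apply: recurrence_eq => [i|i||].
- by rewrite !addnS hw.
- by rewrite lucas_recSS lucas_uSS; ring.
- by rewrite addn0 /lucas_u /lucas_v /=; ring.
- by rewrite addn1 /lucas_u /lucas_v /=; ring.
Qed.

(** With [lucas_uS], this rewrites the pair [(g, u)] at one index through the pair at the preceding
    index, so the inductions below reduce to polynomial identities. *)
Lemma lucas_gS k : g k.+1 = u k.
Proof.
move: k; apply: recurrence_eq => [i|i|//|].
- exact: lucas_recSS.
- exact: lucas_uSS.
- by rewrite /lucas_u /lucas_v /=; ring.
Qed.

Lemma lucas_uS k : u k.+1 = a * u k + g k.
Proof. by case: k => [|k]; rewrite ?lucas_gS ?lucas_uSS // /lucas_u /=; ring. Qed.

Lemma lucas_v_g k : v k = a * u k + 2 * g k.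
Proof.
move: k; apply: recurrence_eq => [i|i||]; rewrite ?lucas_vSS //.
- by rewrite lucas_recSS lucas_uSS; ring.
- by rewrite /lucas_u /lucas_v /=; ring.
- by rewrite /lucas_u /lucas_v /=; ring.
Qed.

(** Each index step negates this quadratic form in [(g, u)], so two steps preserve it. *)
Lemma lucas_cassini_even m :
  g m.*2 ^+ 2 + a * u m.*2 * g m.*2 - u m.*2 ^+ 2 = 1.
Proof.
elim: m => [|m IH]; first by rewrite /lucas_u /=; ring.
by rewrite -[RHS]IH doubleS !(lucas_uS, lucas_gS); ring.
Qed.

Lemma sum_uu m : a * (\sum_(0 <= k < m.*2) u k ^+ 2) = u m.*2 * g m.*2.
Proof.
elim: m => [|m IH]; first by rewrite big_geq ?double0 // mulr0 /lucas_u /= mul0r.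
rewrite doubleS !(lucas_uS, lucas_gS) !big_nat_recr // !mulrDr IH.
by rewrite !(lucas_uS, lucas_gS); ring.
Qed.

(** Since [g] is [u] delayed by one index, this is the sum of [u k ^+ 2] shifted: [u - a * g] is [g]
    one index earlier, and the final [a] comes from [g 0 = 1]. *)
Lemma sum_gg m :
  a * (\sum_(0 <= k < m.*2) g k ^+ 2) = g m.*2 * (u m.*2 - a * g m.*2) + a.
Proof.
elim: m => [|m IH]; first by rewrite big_geq ?double0 // /lucas_u /lucas_v /=; ring.
rewrite doubleS !(lucas_uS, lucas_gS) !big_nat_recr // !mulrDr IH.
by rewrite !(lucas_uS, lucas_gS); ring.
Qed.

(** Here the parity matters: with a single term the sum is 0 while the right-hand side would be
    -1. *)
Lemma sum_gu m : a * (\sum_(0 <= k < m.*2) g k * u k) = g m.*2 ^+ 2 - 1.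
Proof.
elim: m => [|m IH]; first by rewrite big_geq ?double0 // /lucas_u /lucas_v /=; ring.
rewrite doubleS !(lucas_uS, lucas_gS) !big_nat_recr // !mulrDr IH.
by rewrite !(lucas_uS, lucas_gS); ring.
Qed.

End Lucas.

(** Writing the even size as [m.+1.*2] keeps the exponents and indices free of truncated
    subtraction. *)
Lemma char_poly_hankel_rec (K : fieldType) (a : K) (w : nat -> K) (m : nat) :
    a != 0 -> (forall i, w i.+2 = a * w i.+1 + w i) ->
  char_poly (\matrix_(j < m.+1.*2, k < m.+1.*2) w (j + k)%N) =
    'X^(m.+1.*2)
    - ((w 1%N * lucas_v a (-1) m.*2.+1 + w 0%N * lucas_v a (-1) m.*2)
        * (lucas_u a (-1) m.+1.*2 / a)) *: 'X^(m.*2.+1)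
    + ((w 0%N ^+ 2 + a * w 0%N * w 1%N - w 1%N ^+ 2)
        * (lucas_u a (-1) m.+1.*2 ^+ 2 / a ^+ 2)) *: 'X^(m.*2).
Proof.
move=> a0 hw; set n := m.+1.*2.
pose g := lucas_rec a (-1) 1 0; pose u := lucas_u a (-1).
pose Q : 'M[K]_(2, n) := \matrix_(i, k) if i == 0 then g k else u k.
pose M : 'M[K]_2 := \matrix_(i, j) w (i + j)%N.
have sum2 (F : 'I_2 -> K) : \sum_i F i = F 0 + F 1.
  by rewrite !big_ord_recl big_ord0 addr0; congr (_ + F _); apply/val_inj.
have -> : \matrix_(j < n, k < n) w (j + k)%N = Q^T *m (M *m Q).
  apply/matrixP=> j k; rewrite !mxE sum2 !mxE !sum2 !mxE /=.
  have -> : w (j + k)%N = w j * g k + w j.+1 * u k.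
    exact: recurrence_add.
  have -> : w j = w 0%N * g j + w 1%N * u j by exact: (recurrence_add hw 0).
  have -> : w j.+1 = w 1%N * g j + w 2%N * u j.
    exact: (recurrence_add hw 1).
  rewrite addn0 addn1; ring.
(* Sylvester's identity carries the factor ['X^2] on the side of the Hankel matrix, so it must be
   cancellable. *)
have X2 : 'X^2 != 0 :> {poly K} by rewrite monic_neq0 ?monicXn.
apply: (mulfI X2); rewrite char_poly_mulmxC char_poly2.
have gg := sum_gg a m.+1; have uu := sum_uu a m.+1.
have gu := sum_gu a m.+1.
rewrite !big_mkord -/n -/g -/u in gg uu gu.
have cas : g n ^+ 2 = 1 - a * u n * g n + u n ^+ 2.
  by rewrite -(lucas_cassini_even a m.+1) -/n -/g -/u; ring.
set Sgg := \sum_(k < n) g k ^+ 2 in gg.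
set Suu := \sum_(k < n) u k ^+ 2 in uu.
set Sgu := \sum_(k < n) g k * u k in gu.
have eQ : Q *m Q^T = \matrix_(i, j)
    if i == 0 then (if j == 0 then Sgg else Sgu)
    else if j == 0 then Sgu else Suu.
  apply/matrixP=> i j; rewrite !mxE.
  case: ifP => i0; case: ifP => j0; apply: eq_bigr => k _;
    by rewrite !mxE i0 j0 ?expr2 // mulrC.
have w2 : w 2%N = a * w 1%N + w 0%N by exact: hw.
(* Running the recurrence backwards expresses both values of [v] through the pair [(g n, u n)], the
   only one in the closed forms of the sums. *)
have vn : lucas_v a (-1) m.*2.+1 = 2 * u n - a * g n.
  rewrite lucas_v_g /n doubleS /u /g !(lucas_uS, lucas_gS); ring.
have vn' : lucas_v a (-1) m.*2 = 2 * g n - a * (u n - a * g n).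
  rewrite lucas_v_g /n doubleS /u /g !(lucas_uS, lucas_gS); ring.
have etr : \tr (M *m Q *m Q^T) =
    (w 1%N * lucas_v a (-1) m.*2.+1 + w 0%N * lucas_v a (-1) m.*2) * (u n / a).
  (* The closed forms give [a] times each sum, so the trace is scaled by [a]; the determinant below,
     quadratic in the sums, is scaled by [a ^+ 2]. *)
  apply: (mulfI a0); rewrite -mulmxA eQ /mxtrace sum2 !mxE !sum2 !mxE /=.
  transitivity (w 0%N * (a * Sgg + a * Suu)
                + w 1%N * (2 * (a * Sgu) + a * (a * Suu))).
    by rewrite w2; ring.
  rewrite gg uu gu vn vn'.
  transitivity ((w 1%N * (2 * u n - a * g n)
      + w 0%N * (2 * g n - a * (u n - a * g n))) * u n); last by field.
  by ring: cas.
have edet : \det (M *m Q *m Q^T) =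
    (w 0%N ^+ 2 + a * w 0%N * w 1%N - w 1%N ^+ 2) * (u n ^+ 2 / a ^+ 2).
  rewrite -mulmxA eQ det_mulmx !det_mx2 !mxE /=; congr (_ * _).
    by rewrite w2; ring.
  have a20 : a ^+ 2 != 0 by rewrite expf_neq0.
  apply: (mulfI a20); rewrite mulrCA divff // mulr1.
  (* Reducing powers of [g n] by [cas] collapses this scaled Gram determinant to [u n ^+ 2]. *)
  transitivity ((a * Sgg) * (a * Suu) - (a * Sgu) ^+ 2); first by ring.
  rewrite gg uu gu; ring: cas.
rewrite etr edet /n doubleS -!mul_polyC !exprS; ring.
Qed.

Theorem theorem1p4 (R : realType) (A : R[i]) (w : nat -> R[i]) (n : nat)
    (hA : A * (A ^+ 2 + 4) != 0)
    (hw : forall i : nat, (1 <= i)%N -> w i.+1 = A * w i + w i.-1)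
    (hn0 : (0 < n)%N) (hn : ~~ odd n) :
  char_poly (\matrix_(j < n, k < n) w (j + k)%N) =
    'X^n
    - ((w 1%N * lucas_v A (-1) (n - 1) + w 0%N * lucas_v A (-1) (n - 2))
        * (lucas_u A (-1) n / A)) *: 'X^(n - 1)
    + ((w 0%N ^+ 2 + A * w 0%N * w 1%N - w 1%N ^+ 2)
        * (lucas_u A (-1) n ^+ 2 / A ^+ 2)) *: 'X^(n - 2).
Proof.
have [m ->] : exists m, n = m.+1.*2.
  by exists n./2.-1; rewrite prednK ?even_halfK // half_gt0; case: n hn0 hn => [|[]].
have -> : (m.+1.*2 - 1 = m.*2.+1)%N by rewrite doubleS subn1.
have -> : (m.+1.*2 - 2 = m.*2)%N by rewrite doubleS subn2.
apply: char_poly_hankel_rec; last by move=> i; exact: hw.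
by apply: contraNneq hA => ->; rewrite mul0r.
Qed.
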